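(* There exist universal constants $\beta>0$ and $c>1$ such that the following holds for all sufficiently large $\ell$ and $\ell'$, every $t\le 2^{\ell/5}$, and every $\rho,\epsilon$ with $2^{-\ell/5}\le\rho\le\beta\cdot\epsilon^2$. If $(\operatorname{Con},\operatorname{Red})$ is a $\rho$-nontrivial nonuniform black-box proof for hard-core predicates for hard-to-invert functions with parameters $\ell,\ell',\rho,\epsilon$ that uses $q$ queries and $t$ bits of advice, then \[ q\ \ge\ \frac{1}{\epsilon^{\beta}}-c\,(t+\ell). \]
   Context: $U_m$ denotes the uniform distribution on $\{0,1\}^m$. For a random variable $Y$, its min-entropy is $H_\infty(Y)=\min_y\log_2\frac{1}{\Pr[Y=y]}$ (minimum over $y$ in the support). A pair $(\operatorname{Con},\operatorname{Red})$ is a nonuniform black-box proof for hard-core predicates for hard-to-invert functions with parameters $\ell,\ell',\rho,\epsilon$, that uses $q$ queries and $t$ bits of advice, if: $\operatorname{Con}$ is an arbitrary map that given any function $f:\{0,1\}^\ell\to\{0,1\}^\ell$ produces two functions $\operatorname{Con}(f)=(f^{\mathrm{newOWF}},f^{\mathrm{pred}})$ with $f^{\mathrm{newOWF}}:\{0,1\}^{\ell'}\to\{0,1\}^{\ell'}$ and $f^{\mathrm{pred}}:\{0,1\}^{\ell'}\to\{0,1\}$; $\operatorname{Red}$ is an oracle procedure (of arbitrary complexity) with two oracles, a function $h:\{0,1\}^{\ell'}\to\{0,1\}$ and the function $f:\{0,1\}^\ell\to\{0,1\}^\ell$, taking inputs $y\in\{0,1\}^\ell$ and $\alpha\in\{0,1\}^t$,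 which makes at most $q$ queries to each of its two oracles; and for all $f:\{0,1\}^\ell\to\{0,1\}^\ell$ and $h:\{0,1\}^{\ell'}\to\{0,1\}$ with $\Pr_{x\leftarrow U_{\ell'}}[h(f^{\mathrm{newOWF}}(x))=f^{\mathrm{pred}}(x)]\ge\frac12+\epsilon$, there exists $\alpha\in\{0,1\}^t$ such that $\Pr_{x\leftarrow U_\ell}[\operatorname{Red}^{h,f}(f(x),\alpha)\in f^{-1}(f(x))]\ge\rho$. The pair is $\rho$-nontrivial if for every $f$, with $(f^{\mathrm{newOWF}},f^{\mathrm{pred}})=\operatorname{Con}(f)$: (i) there exists a function $\phi_f:\{0,1\}^{\ell'}\to\{0,1\}$ such that $\phi_f(f^{\mathrm{newOWF}}(x))=f^{\mathrm{pred}}(x)$ for every $x\in\{0,1\}^{\ell'}$, and (ii) $H_\infty(f^{\mathrm{newOWF}}(U_{\ell'}))\ge\log_2(1/\rho)$. *)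

(* Defs.v *)
From HB Require Import structures.
From mathcomp Require Import all_boot all_order all_algebra.
From mathcomp Require Import reals constructive_ereal exp.

Set Implicit Arguments.
Unset Strict Implicit.
Unset Printing Implicit Defensive.

Import Order.TTheory GRing.Theory Num.Theory.
Local Open Scope ring_scope.

Definition bits (m : nat) : finType := m.-tuple bool.

Definition log2 (R : realType) (x : R) : R := ln x / ln 2.

(* Pr_{x <- U}[P x] for U uniform on the finite type T *)
Definition unif_pr (R : realType) (T : finType) (P : pred T) : R :=
  #|P|%:R / #|T|%:R.

(* the probability mass function of g(U), U uniform on T *)
Definition unif_image (R : realType) (T V : finType) (g : T -> V) : V -> R :=
  fun v => unif_pr R (fun x => g x == v).

(* The neutral element +oo is only reached on an empty support, which does not
   occur for a probability mass function. *)
Definition min_entropy (R : realType) (V : finType) (p : V -> R) : \bar R :=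
  \big[Order.min/+oo%E]_(v | 0 < p v) (log2 (1 / p v))%:E.

(* A deterministic adaptive computation with two oracles
   h : X1 -> A1 and f : X2 -> A2, as a (well-founded) decision tree. *)
Inductive oracle_tree (X1 A1 X2 A2 O : Type) : Type :=
| Output (o : O)
| QueryH (x : X1) (k : A1 -> oracle_tree X1 A1 X2 A2 O)
| QueryF (x : X2) (k : A2 -> oracle_tree X1 A1 X2 A2 O).

Section Run.
Variables (X1 A1 X2 A2 O : Type) (h : X1 -> A1) (f : X2 -> A2).

Fixpoint run (T : oracle_tree X1 A1 X2 A2 O) : O :=
  match T with
  | Output o => o
  | QueryH x k => run (k (h x))
  | QueryF x k => run (k (f x))
  end.

Fixpoint queriesH (T : oracle_tree X1 A1 X2 A2 O) : nat :=
  match T with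
  | Output _ => 0
  | QueryH x k => (queriesH (k (h x))).+1
  | QueryF x k => queriesH (k (f x))
  end.

Fixpoint queriesF (T : oracle_tree X1 A1 X2 A2 O) : nat :=
  match T with
  | Output _ => 0
  | QueryH x k => queriesF (k (h x))
  | QueryF x k => (queriesF (k (f x))).+1
  end.

End Run.

(* Con(f) = (newOWF, pred) *)
Definition construction (l l' : nat) : Type :=
  {ffun bits l -> bits l} ->
  {ffun bits l' -> bits l'} * {ffun bits l' -> bool}.

(* Inputs y and alpha, oracles h (on l' bits) and f (on l bits). *)
Definition reduction (l l' t : nat) : Type :=
  bits l -> bits t -> oracle_tree (bits l') bool (bits l) (bits l) (bits l).

Definition makes_at_most_queries (l l' t q : nat) (Red : reduction l l' t) :
    Prop :=
  forall (h : {ffun bits l' -> bool}) (f : {ffun bits l -> bits l})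
    (y : bits l) (alpha : bits t),
    (queriesH h f (Red y alpha) <= q)%N /\ (queriesF h f (Red y alpha) <= q)%N.

Definition nonuniform_bb_proof (R : realType) (l l' : nat) (rho eps : R)
    (q t : nat) (Con : construction l l') (Red : reduction l l' t) : Prop :=
  makes_at_most_queries q Red /\
  forall (f : {ffun bits l -> bits l}) (h : {ffun bits l' -> bool}),
    1 / 2 + eps <= unif_pr R (fun x : bits l' => h ((Con f).1 x) == (Con f).2 x) ->
    exists alpha : bits t,
      rho <= unif_pr R (fun x : bits l => f (run h f (Red (f x) alpha)) == f x).

(* This depends on the pair (Con, Red) through Con only. *)
Definition nontrivial (R : realType) (l l' : nat) (rho : R)
    (Con : construction l l') : Prop :=
  forall f : {ffun bits l -> bits l},
    (exists phi : bits l' -> bool,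
       forall x : bits l', phi ((Con f).1 x) = (Con f).2 x) /\
    ((log2 (1 / rho))%:E <= min_entropy (unif_image R (Con f).1))%E.

(* Main.v *)
(** Draw [f] uniformly and let [h] agree with [phi_f] independently at each
    point with probability [1/2 + 2 eps].  The min-entropy condition bounds the
    variance of the agreement by [rho / 4 <= eps^2 / 4], so by Chebyshev [h]
    meets the hypothesis of the reduction with probability at least 3/4.  For a
    fixed advice string and [k] fixed targets, replacing [h] by a uniform function
    independent of [f] costs a factor [(1 + 4 eps)^(qk)], and then [k(q+1)] queries
    to a random [f] return all [k] targets with probability at most
    [(k(q+1) / 2^l)^k].  The [k]-th factorial moment of the number of inverted
    points, with [k = t + 1], makes success on a [rho] fraction less likely than
    [4^-k], which beats the union bound over the [2^t] advice strings.  This gives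
    the theorem with [beta = 1] and [c = 2]. *)
Require Import Defs.
From mathcomp Require Import all_boot all_order all_algebra.
From mathcomp Require Import reals constructive_ereal exp.
From mathcomp Require Import ring lra.
Import Order.TTheory GRing.Theory Num.Theory.
Local Open Scope ring_scope.

Set Implicit Arguments.
Unset Strict Implicit.
Unset Printing Implicit Defensive.

(** * Random functions with independent values *)

Section ProductMeasure.
Variables (R : realFieldType) (X A : finType).
Implicit Types (w u : X -> A -> R) (F G : {ffun X -> A} -> R).

Definition prob_weights w :=
  (forall x a, 0 <= w x a) /\ (forall x, \sum_a w x a = 1).

Definition expect w F : R := \sum_(g : {ffun X -> A}) (\prod_x w x (g x)) * F g.

(** Conditioning on the value at [x] only replaces that coordinate by a point mass, so product
    measures are closed under it. This lets inductions over decision trees run with [w]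
    generalized. *)
Definition fix_coord w (x : X) (b : A) : X -> A -> R :=
  fun x' a => if x' == x then (a == b)%:R else w x' a.

Lemma fix_coord_prob w x b : prob_weights w -> prob_weights (fix_coord w x b).
Proof.
move=> [w0 w1]; split=> [x' a|x']; rewrite /fix_coord; case: eqP => // _.
by rewrite (bigD1 b) //= eqxx big1 ?addr0 // => a /negPf->.
Qed.

(** Total probability over the answer at [x]: under [fix_coord w x b] every [g] with [g x != b] has
    weight zero. Passing the answer to [F] separately matches a query node, whose subtree is
    selected by that answer. *)
Lemma expect_cond w x (F : A -> {ffun X -> A} -> R) :
  expect w (fun g => F (g x) g) = \sum_b w x b * expect (fix_coord w x b) (F b).
Proof.
rewrite /expect; under [RHS]eq_bigr do rewrite mulr_sumr.
rewrite exchange_big; apply: eq_bigr => g _ /=.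
rewrite (bigD1 (g x)) //= [X in _ + X]big1 ?addr0 => [|b bg].
  rewrite !mulrA; congr (_ * _); rewrite !(bigD1 (P := predT) x) //=.
  rewrite /fix_coord !eqxx mul1r; congr (_ * _).
  by apply: eq_bigr => x' /negPf->.
rewrite (bigD1 x) //= /fix_coord eqxx eq_sym (negPf bg).
by rewrite !mul0r mulr0.
Qed.

Lemma expect_cst w c : prob_weights w -> expect w (fun=> c) = c.
Proof.
move=> [_ w1]; rewrite /expect -mulr_suml -(bigA_distr_bigA (fun x a => w x a)).
by under eq_bigr do rewrite w1; rewrite big1_eq mul1r.
Qed.

Lemma ler_expect w F G : prob_weights w -> (forall g, F g <= G g) ->
  expect w F <= expect w G.
Proof.
move=> [w0 _] FG; apply: ler_sum => g _; apply: ler_wpM2l => //.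
exact: prodr_ge0.
Qed.

Lemma eq_expect w F G : F =1 G -> expect w F = expect w G.
Proof. by move=> FG; apply: eq_bigr => g _; rewrite FG. Qed.

Lemma expectD w F G : expect w (fun g => F g + G g) = expect w F + expect w G.
Proof. by rewrite -big_split; apply: eq_bigr => g _; rewrite mulrDr. Qed.

Lemma expectZ w c F : expect w (fun g => c * F g) = c * expect w F.
Proof. by rewrite mulr_sumr; apply: eq_bigr => g _; rewrite mulrCA. Qed.

Lemma expect_sum (I : finType) (P : pred I) w (F : I -> {ffun X -> A} -> R) :
  expect w (fun g => \sum_(i | P i) F i g) = \sum_(i | P i) expect w (F i).
Proof. by rewrite exchange_big; apply: eq_bigr => g _; rewrite mulr_sumr. Qed.

Lemma expect1 w x (G : A -> R) : prob_weights w ->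
  expect w (fun g => G (g x)) = \sum_a w x a * G a.
Proof.
move=> wP; rewrite (expect_cond w x (fun a _ => G a)).
by apply: eq_bigr => a _; rewrite expect_cst //; apply: fix_coord_prob.
Qed.

Lemma expect2 w x x' (G : A -> A -> R) : prob_weights w -> x' != x ->
  expect w (fun g => G (g x) (g x')) =
  \sum_a w x a * \sum_a' w x' a' * G a a'.
Proof.
move=> wP xx; rewrite (expect_cond w x (fun a g => G a (g x'))).
apply: eq_bigr => a _; rewrite expect1; last exact: fix_coord_prob.
by congr (_ * _); apply: eq_bigr => a' _; rewrite /fix_coord (negPf xx).
Qed.

End ProductMeasure.

Lemma expect_swap (R : realFieldType) (X A X' A' : finType)
    (w : X -> A -> R) (w' : X' -> A' -> R) (F : {ffun X -> A} -> {ffun X' -> A'} -> R) :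
  expect w (fun g => expect w' (F g)) = expect w' (fun g' => expect w (F^~ g')).
Proof.
rewrite /expect; under eq_bigr do rewrite mulr_sumr.
rewrite exchange_big; apply: eq_bigr => g' _ /=; rewrite mulr_sumr.
by apply: eq_bigr => g _; rewrite mulrCA.
Qed.

(** * Decision trees run on random oracles *)

Section Trees.
Variables X1 A1 X2 A2 : finType.
Implicit Types (h : {ffun X1 -> A1}) (f : {ffun X2 -> A2}).
Local Notation tree := (oracle_tree X1 A1 X2 A2).

Fixpoint bind_tree (O O' : Type) (T : tree O) (g : O -> tree O') : tree O' :=
  match T with
  | Output o => g o
  | QueryH x k => QueryH x (fun a => bind_tree (k a) g)
  | QueryF x k => QueryF x (fun a => bind_tree (k a) g)
  end.

Fixpoint answersF (O : Type) h f (T : tree O) : seq A2 :=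
  match T with
  | Output _ => [::]
  | QueryH x k => answersF h f (k (h x))
  | QueryF x k => f x :: answersF h f (k (f x))
  end.

Lemma run_bind O O' h f (T : tree O) (g : O -> tree O') :
  run h f (bind_tree T g) = run h f (g (run h f T)).
Proof. by elim: T => //= x k IH; rewrite IH. Qed.

Lemma queriesH_bind O O' h f (T : tree O) (g : O -> tree O') :
  queriesH h f (bind_tree T g) =
  (queriesH h f T + queriesH h f (g (run h f T)))%N.
Proof. by elim: T => //= x k IH; rewrite IH ?addSn. Qed.

Lemma queriesF_bind O O' h f (T : tree O) (g : O -> tree O') :
  queriesF h f (bind_tree T g) =
  (queriesF h f T + queriesF h f (g (run h f T)))%N.
Proof. by elim: T => //= x k IH; rewrite IH ?addSn. Qed.

Lemma answersF_bind O O' h f (T : tree O) (g : O -> tree O') :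
  answersF h f (bind_tree T g) =
  answersF h f T ++ answersF h f (g (run h f T)).
Proof. by elim: T => //= x k IH; rewrite IH. Qed.

(** Merges the attempts on all targets into one tree, to which the measure bounds apply once. The
    extra query checking each candidate forces every inverted target to occur among the answers of
    [f]; it is why [q.+1] appears below. *)
Fixpoint invert_all (B : A2 -> tree X2) (ys : seq A2) : tree bool :=
  if ys is y :: ys' then
    bind_tree (B y) (fun x => QueryF x (fun a =>
      if a == y then invert_all B ys' else Output _ _ _ _ false))
  else Output _ _ _ _ true.

Lemma run_invert_all h f B ys :
  run h f (invert_all B ys) = all (fun y => f (run h f (B y)) == y) ys.
Proof. by elim: ys => //= y ys IH; rewrite run_bind /=; case: eqP. Qed.

Lemma queriesH_invert_all h f B ys q :
  (forall y, queriesH h f (B y) <= q)%N ->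
  (queriesH h f (invert_all B ys) <= q * size ys)%N.
Proof.
move=> Bq; elim: ys => //= y ys IH; rewrite queriesH_bind mulnS /=.
by rewrite leq_add //; case: eqP.
Qed.

Lemma queriesF_invert_all h f B ys q :
  (forall y, queriesF h f (B y) <= q)%N ->
  (queriesF h f (invert_all B ys) <= q.+1 * size ys)%N.
Proof.
move=> Bq; elim: ys => //= y ys IH; rewrite queriesF_bind mulnS /=.
by rewrite addnS addSn ltnS leq_add //; case: eqP.
Qed.

Lemma answersF_invert_all h f B ys :
  run h f (invert_all B ys) -> {subset ys <= answersF h f (invert_all B ys)}.
Proof.
elim: ys => [//|y ys IH]; rewrite [invert_all _ _]/= run_bind answersF_bind /=.
case: eqP => [fy run_ys z|//]; rewrite inE mem_cat inE fy.
by case/orP=> [->|/IH->//]; rewrite ?orbT.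
Qed.

Variable R : realFieldType.

(* Each oracle query multiplies the likelihood ratio by at most lam; repeated
   queries may be charged again since 1 <= lam. *)
Lemma expect_run_change_measure (w u : X1 -> A1 -> R) (lam : R) f (T : tree bool) :
  prob_weights w -> prob_weights u -> 1 <= lam ->
  (forall x a, w x a <= lam * u x a) ->
  expect w (fun h => (run h f T)%:R) <=
  expect u (fun h => lam ^+ queriesH h f T * (run h f T)%:R).
Proof.
move=> + + lam1; elim: T w u => [o|x k IH|x k IH] w u wP uP wu /=.
- by rewrite !expect_cst // expr0 mul1r.
- rewrite (expect_cond w x (fun b h => (run h f (k b))%:R)).
  rewrite (expect_cond u x
    (fun b h => lam ^+ (queriesH h f (k b)).+1 * (run h f (k b))%:R)).
  apply: ler_sum => b _.
  (* One factor [lam] is detached to pay for replacing [w x b] by [u x b]; the remaining power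
     belongs to the subtree and the induction hypothesis. *)
  under [X in _ <= _ * X]eq_expect do rewrite exprS -mulrA.
  rewrite expectZ mulrA [u x b * _]mulrC.
  have lam0 : 0 <= lam by exact: le_trans ler01 lam1.
  apply: ler_pM => //; first by case: wP.
    rewrite -(expect_cst 0 (fix_coord_prob x b wP)).
    by apply: ler_expect => //; apply: fix_coord_prob.
  apply: IH; try exact: fix_coord_prob.
  move=> x' a; rewrite /fix_coord; case: eqP => // _.
  by case: (a == b); rewrite ?mulr1 ?mulr0.
- exact: IH.
Qed.

(** These are two terms of the binomial expansion. With [a = d * kap] and [b = kap] they account for
    one more query that hits one of [j] targets or misses them all. At [j = 0] the coefficient kills
    the truncated exponent. *)
Lemma exprD1_ge (a b : R) j : 0 <= a -> 0 <= b ->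
  j%:R * b * a ^+ j.-1 + a ^+ j <= (a + b) ^+ j.
Proof.
move=> a0 b0; elim: j => [|j IH] /=; first by rewrite !mul0r add0r !expr0.
rewrite [X in _ <= X]exprS; apply: le_trans (ler_wpM2l (addr_ge0 a0 b0) IH).
case: j {IH} => [|j] /=; first by rewrite !mul0r add0r !expr0 expr1 !mulr1 addrC mul1r.
have -> : (a + b) * (j.+1%:R * b * a ^+ j + a ^+ j.+1) =
  j.+2%:R * b * a ^+ j.+1 + a ^+ j.+2 + j.+1%:R * b ^+ 2 * a ^+ j.
  by rewrite -[in RHS]natr1 !exprS; ring.
by rewrite lerDl !mulr_ge0 ?exprn_ge0.
Qed.

(* Answers are fresh draws: an answer that was already given has been removed
   from Y, so it does not matter that its coordinate is now deterministic. *)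
Lemma expect_answersF (O : Type) h (w : X2 -> A2 -> R) (kap : R) (Y : {set A2}) d
    (T : tree O) :
  prob_weights w -> 0 <= kap -> (forall x y, y \in Y -> w x y <= kap) ->
  expect w (fun f => ((Y \subset answersF h f T) && (queriesF h f T <= d)%N)%:R)
  <= (d%:R * kap) ^+ #|Y|.
Proof.
move=> + kap0; elim: T w Y d => [o|x k IH|x k IH] w Y d wP wY /=.
- rewrite expect_cst // andbT.
  have [->|[y yY]] := set_0Vmem Y; first by rewrite cards0 expr0 lern1 leq_b1.
  case: subsetP => [/(_ y yY)//|_].
  by rewrite exprn_ge0 ?mulr_ge0.
- exact: IH.
case: d => [|d].
  under eq_expect do rewrite ltn0 andbF.
  by rewrite expect_cst // exprn_ge0 ?mulr_ge0.
rewrite (expect_cond w x (fun b f => ((Y \subset b :: answersF h f (k b)) &&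
   (queriesF h f (k b) < d.+1)%N)%:R)).
have [w0 w1] := wP; set a := d%:R * kap.
have a0 : 0 <= a by rewrite mulr_ge0.
have step b : w x b * expect (fix_coord w x b) (fun f =>
    ((Y \subset b :: answersF h f (k b)) && (queriesF h f (k b) < d.+1)%N)%:R)
    <= w x b * a ^+ #|Y :\ b|.
  apply: ler_wpM2l => //; apply: le_trans (IH b (fix_coord w x b) _ d _ _).
  - apply: ler_expect; first exact: fix_coord_prob.
    move=> f; rewrite ler_nat ltnS; case: (_ <= d)%N; rewrite ?andbF // !andbT.
    case: subsetP => // YS; suff -> : Y :\ b \subset answersF h f (k b) by [].
    by apply/subsetP=> y; rewrite !inE => /andP[/negPf yb /YS]; rewrite inE yb.
  - exact: fix_coord_prob.
  - move=> x' y; rewrite !inE /fix_coord => /andP[/negPf yb yY].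
    by case: eqP => _; rewrite ?yb //; apply: wY.
apply: le_trans (ler_sum _ (fun b _ => step b)) _.
(* Split on whether the first answer hits [Y]: each hit has weight at most [kap] and leaves one
   target fewer, while the misses have total weight at most 1 and leave [Y] intact. *)
rewrite (bigID (mem Y)) /=.
have -> : d.+1%:R * kap = a + kap by rewrite -natr1 mulrDl mul1r.
apply: le_trans (exprD1_ge _ a0 kap0); apply: lerD.
  have -> : #|Y|%:R * kap * a ^+ #|Y|.-1 = \sum_(b in Y) kap * a ^+ #|Y|.-1.
    by rewrite sumr_const -mulrA mulr_natl.
  apply: ler_sum => b bY; rewrite (cardsD1 b Y) bY /=.
  by apply: ler_wpM2r; [exact: exprn_ge0 | exact: wY].
have -> : \sum_(b | b \notin Y) w x b * a ^+ #|Y :\ b| =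
    (\sum_(b | b \notin Y) w x b) * a ^+ #|Y|.
  rewrite mulr_suml; apply: eq_bigr => b bY.
  by rewrite [in RHS](cardsD1 b Y) (negPf bY).
rewrite ler_piMl ?exprn_ge0 // -(w1 x) [leRHS](bigID (mem Y)) /=.
by rewrite lerDr sumr_ge0.
Qed.

End Trees.

(** * Distributions of the oracles, and second-moment bounds *)

Definition uniform_weights (R : realFieldType) (X A : finType) : X -> A -> R :=
  fun _ _ => #|A|%:R^-1.

(** The bias [2 * eps] is twice the advantage required, leaving a margin [eps] for deviations; the
    likelihood ratio to a fair coin is at most [1 + 4 * eps]. *)
Definition noisy_weights (R : realFieldType) (V : finType) (eps : R)
    (phi : V -> bool) : V -> bool -> R :=
  fun v b => if b == phi v then 1 / 2 + 2 * eps else 1 / 2 - 2 * eps.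

Section Concentration.
Variable R : realFieldType.

Lemma uniform_weights_prob (X A : finType) : (0 < #|A|)%N ->
  prob_weights (@uniform_weights R X A).
Proof.
move=> A0; split=> [x a|x]; first by rewrite invr_ge0.
by rewrite sumr_const -[LHS]mulr_natl mulfV // pnatr_eq0 -lt0n.
Qed.

Lemma noisy_weights_prob (V : finType) (eps : R) (phi : V -> bool) :
  0 <= eps <= 1 / 4 -> prob_weights (noisy_weights eps phi).
Proof.
move=> eps_bnd; split=> [v b|v]; rewrite /noisy_weights.
  by case: ifP => _; lra.
by rewrite big_bool /=; case: (phi v) => /=; lra.
Qed.

(** Chebyshev: the agreement has mean [1/2 + 2 * eps], and its variance is at most a quarter of the
    sum of the [p v ^+ 2], hence at most [rho / 4]. *)
Lemma noisy_agreement_tail (V : finType) (p : V -> R) (phi : V -> bool)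
    (rho eps : R) :
  (forall v, 0 <= p v) -> \sum_v p v = 1 -> (forall v, p v <= rho) ->
  0 < eps <= 1 / 4 -> rho <= eps ^+ 2 ->
  expect (noisy_weights eps phi)
    (fun h => (\sum_v p v * (h v == phi v)%:R < 1 / 2 + eps)%R%:R) <= 1 / 4.
Proof.
move=> p0 p1 p_le eps_bnd rho_le; set w := noisy_weights eps phi.
have wP : prob_weights w by apply: noisy_weights_prob; lra.
pose D v b : R := (b == phi v)%:R - (1 / 2 + 2 * eps).
have mean0 v : \sum_b w v b * D v b = 0.
  by rewrite /D /w /noisy_weights big_bool; case: (phi v) => /=; field.
have var_le v : \sum_b w v b * (D v b * D v b) <= 1 / 4.
  rewrite /D /w /noisy_weights big_bool.
  by case: (phi v) => /=; have := sqr_ge0 eps; rewrite expr2; nra.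
have tail (h : {ffun V -> bool}) :
  (\sum_v p v * (h v == phi v)%:R < 1 / 2 + eps)%R%:R <=
    eps ^- 2 * \sum_v \sum_v' p v * p v' * (D v (h v) * D v' (h v')).
  have -> : \sum_v \sum_v' p v * p v' * (D v (h v) * D v' (h v')) =
      (\sum_v p v * (h v == phi v)%:R - (1 / 2 + 2 * eps)) ^+ 2.
    have -> : \sum_v p v * (h v == phi v)%:R - (1 / 2 + 2 * eps) =
        \sum_v p v * D v (h v).
      under [RHS]eq_bigr do rewrite mulrBr.
      by rewrite sumrB -[X in _ = _ - X]mulr_suml p1 [1 * (_ + _)]mul1r.
    rewrite expr2 mulr_suml; apply: eq_bigr => v _; rewrite mulr_sumr.
    by apply: eq_bigr => v' _; ring.
  have e2 : 0 < eps ^+ 2 by rewrite exprn_gt0; lra.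
  rewrite [leRHS]mulrC ler_pdivlMr //; case: ltP => /= [lt|_]; last first.
    by rewrite mul0r sqr_ge0.
  by rewrite mul1r !expr2; nra.
apply: le_trans (ler_expect wP tail) _.
rewrite expectZ expect_sum.
under eq_bigr do rewrite expect_sum.
under eq_bigr do under eq_bigr do rewrite expectZ.
(* Off-diagonal covariances vanish by independence and centring; on the diagonal one factor [p v] is
   bounded by [rho]. *)
have row v : \sum_v' p v * p v' * expect w (fun h => D v (h v) * D v' (h v'))
    <= p v * (rho / 4).
  rewrite (bigD1 v) //= [X in _ + X]big1 ?addr0 => [|v' vv].
    rewrite (expect1 v (fun b => D v b * D v b) wP) -mulrA ler_wpM2l //.
    have := ler_pM (p0 v) _ (p_le v) (var_le v); rewrite mul1r; apply.
    by apply: sumr_ge0 => b _; rewrite mulr_ge0 -?expr2 ?sqr_ge0 //; case: wP.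
  rewrite (expect2 (fun b b' => D v b * D v' b') wP vv) big1 ?mulr0 // => b _.
  under eq_bigr do rewrite mulrCA.
  by rewrite -mulr_sumr mean0 !mulr0.
have e2 : 0 < eps ^+ 2 by rewrite exprn_gt0; lra.
rewrite mulrC ler_pdivrMr //.
apply: le_trans (ler_sum _ (fun v _ => row v)) _.
by rewrite -mulr_suml p1 mul1r; lra.
Qed.

(** Ordered pairs, diagonal included, so that this is the sum of the squared fiber sizes. *)
Definition collisions (X A : finType) (f : {ffun X -> A}) : R :=
  \sum_x \sum_x' (f x == f x')%:R.

(** Markov: each [x] collides with itself and with any other point with probability [1 / #|A|], so
    the mean is at most [2 * #|A|], a quarter of the threshold. *)
Lemma collisions_tail (X A : finType) : (0 < #|A|)%N -> #|X| = #|A| ->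
  expect (@uniform_weights R X A)
    (fun f => (8 * #|A|%:R < collisions f)%R%:R) <= 1 / 4.
Proof.
move=> A0 XA; have wP := uniform_weights_prob X A0.
have M0 : 0 < #|A|%:R :> R by rewrite ltr0n.
have tail (f : {ffun X -> A}) : (8 * #|A|%:R < collisions f)%R%:R <=
    (8 * #|A|%:R)^-1 * collisions f.
  have c0 : 0 <= collisions f by do 2!apply: sumr_ge0 => ? _.
  rewrite [leRHS]mulrC ler_pdivlMr; last lra.
  by case: ltP => /= [/ltW|_]; rewrite ?mul1r ?mul0r.
apply: le_trans (ler_expect wP tail) _.
rewrite expectZ expect_sum; under eq_bigr do rewrite expect_sum.
have row x : \sum_x' expect (@uniform_weights R X A) (fun f => (f x == f x')%:R)
   <= 2.
  rewrite (bigD1 x) //=; apply: (@le_trans _ _ (1 + \sum_(x' : X) #|A|%:R^-1)).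
    apply: lerD.
      rewrite -[leRHS](expect_cst 1 wP); apply: ler_expect => // f.
      by rewrite eqxx.
    rewrite [leRHS](bigD1 x) //= ler_wpDl ?invr_ge0 //; apply: ler_sum => x' xx.
    rewrite (expect2 (fun a b => (a == b)%:R) wP xx).
    rewrite le_eqVlt; apply/orP; left; apply/eqP.
    rewrite -[RHS](expect_cst _ wP) (expect1 x (fun=> _) wP).
    apply: eq_bigr => a _; congr (_ * _); rewrite (bigD1 a) //= eqxx mulr1.
    by rewrite big1 ?addr0 // => b /negPf; rewrite eq_sym => ->; rewrite mulr0.
  rewrite sumr_const XA -[X in 1 + X]mulr_natl mulfV; first lra.
  by rewrite lt0r_neq0.
rewrite [leLHS]mulrC ler_pdivrMr; last lra.
apply: le_trans (ler_sum _ (fun x _ => row x)) _.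
rewrite sumr_const XA -mulr_natl; lra.
Qed.

(* AM-GM on each fiber size n_y: n_y <= c + n_y^2 / (4 c) with c = 4 / rho. *)
Lemma image_count_ge (X A : finType) (f : {ffun X -> A}) (G : {set A}) (rho : R) :
  0 < rho -> collisions f <= 8 * #|A|%:R ->
  rho * #|A|%:R <= #|[pred x | f x \in G]|%:R ->
  rho ^+ 2 * #|A|%:R / 8 <= #|G|%:R.
Proof.
move=> rho0 coll S_ge.
pose n y : R := \sum_x (f x == y)%:R.
have SE : #|[pred x | f x \in G]|%:R = \sum_(y in G) n y.
  rewrite exchange_big -sum1_card natr_sum big_mkcond; apply: eq_bigr => x _ /=.
  rewrite inE; case: ifP => fG.
    rewrite (bigD1 (f x)) //= eqxx big1 ?addr0 // => y /andP[_ /negPf].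
    by rewrite eq_sym => ->.
  by rewrite big1 // => y yG; case: eqP => // fy; rewrite fy yG in fG.
have collE : collisions f = \sum_y n y ^+ 2.
  under [RHS]eq_bigr do rewrite expr2 mulr_suml.
  rewrite exchange_big; apply: eq_bigr => x _ /=.
  rewrite (bigD1 (f x)) //= eqxx mul1r [X in _ + X]big1 ?addr0.
    by apply: eq_bigr => x' _; rewrite eq_sym.
  by move=> y /negPf; rewrite eq_sym => ->; rewrite mul0r.
have amgm y : n y <= 4 / rho + rho / 16 * n y ^+ 2.
  rewrite -subr_ge0.
  have -> : 4 / rho + rho / 16 * n y ^+ 2 - n y =
     (4 / rho) * (1 - rho * n y / 8) ^+ 2.
    by field; rewrite lt0r_neq0.
  by rewrite mulr_ge0 ?sqr_ge0 // divr_ge0 // ltW.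
have S_le : #|[pred x | f x \in G]|%:R <= 4 / rho * #|G|%:R + rho / 16 * collisions f.
  rewrite SE; apply: le_trans (ler_sum _ (fun y _ => amgm y)) _.
  rewrite big_split /= sumr_const -[X in X + _ <= _]mulr_natr lerD2l -mulr_sumr.
  apply: ler_wpM2l; first lra.
  rewrite collE [leRHS](bigID (mem G)) /= lerDl sumr_ge0 // => y _.
  exact: sqr_ge0.
(* The collision term is at most [rho / 16 * 8 * #|A|], half of the assumed lower bound. *)
have main : rho * #|A|%:R / 2 <= 4 / rho * #|G|%:R by nra.
rewrite -(@ler_pM2l _ (4 / rho)) ?divr_gt0 //; apply: le_trans main.
rewrite le_eqVlt; apply/orP; left; apply/eqP; field; by rewrite lt0r_neq0.
Qed.

End Concentration.

(** * Factorial moments of the number of inverted points *)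

Lemma ffact_ge_exp n k : ((n - k) ^ k <= n ^_ k)%N.
Proof.
rewrite ffact_prod -[X in (_ ^ X)%N]card_ord -prod_nat_const.
by apply: leq_prod => i _; rewrite leq_sub2l // ltnW.
Qed.

Lemma ffact_le_exp n k : (n ^_ k <= n ^ k)%N.
Proof.
rewrite ffact_prod -[X in (_ ^ X)%N]card_ord -prod_nat_const.
by apply: leq_prod => i _; rewrite leq_subr.
Qed.

Section InversionTail.
Variables (R : realFieldType) (X1 X2 A2 : finType) (q : nat) (eps : R).
Variable phi : {ffun X2 -> A2} -> X1 -> bool.
Variable B : A2 -> oracle_tree X1 bool X2 A2 X2.
Hypothesis A2_gt0 : (0 < #|A2|)%N.
Hypothesis eps_bnd : 0 <= eps <= 1 / 4.
Hypothesis B_queries : forall (h : {ffun X1 -> bool}) (f : {ffun X2 -> A2}) y,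
  (queriesH h f (B y) <= q)%N /\ (queriesF h f (B y) <= q)%N.

Let unif := @uniform_weights R X2 A2.

(** Counts images rather than inputs: success probability weights each image by its fiber, and
    [image_count_ge] passes from one to the other. *)
Definition inverted (h : {ffun X1 -> bool}) (f : {ffun X2 -> A2}) : {set A2} :=
  [set y | f (run h f (B y)) == y].

(** For each fixed [f] the change of measure makes [h] uniform, however [phi f] depends on [f]. Then
    [h] is independent of [f], the expectations can be swapped, and for fixed [h] all targets must
    be hit by fresh answers of [f]. *)
Lemma expect_subset_inverted (Y : {set A2}) :
  expect unif (fun f => expect (noisy_weights eps (phi f))
    (fun h => (Y \subset inverted h f)%:R)) <=
  (1 + 4 * eps) ^+ (q * #|Y|) * ((q.+1 * #|Y|)%:R / #|A2|%:R) ^+ #|Y|.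
Proof.
have eps_bnd' := eps_bnd; pose T := invert_all B (enum Y).
have lam1 : 1 <= 1 + 4 * eps by lra.
have unifP : prob_weights unif by exact: uniform_weights_prob.
have coinP : prob_weights (@uniform_weights R X1 bool).
  by apply: uniform_weights_prob; rewrite card_bool.
have runE h f : (Y \subset inverted h f) = run h f T.
  rewrite run_invert_all; apply/subsetP/allP => inv y.
    by rewrite mem_enum => /inv; rewrite inE.
  by move=> yY; rewrite inE; apply: inv; rewrite mem_enum.
have uniform_h f : expect (noisy_weights eps (phi f))
    (fun h => (Y \subset inverted h f)%:R) <=
  (1 + 4 * eps) ^+ (q * #|Y|) *
    expect (@uniform_weights R X1 bool) (fun h => (run h f T)%:R).
  under eq_expect do rewrite runE.
  apply: le_trans (expect_run_change_measure f T
    (noisy_weights_prob _ eps_bnd) coinP lam1 _) _.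
    move=> x b; rewrite /uniform_weights /noisy_weights card_bool.
    by case: ifP => _; lra.
  rewrite -expectZ; apply: ler_expect => // h; apply: ler_wpM2r => //.
  rewrite ler_weXn2l // cardE; apply: queriesH_invert_all => y.
  by have [] := B_queries h f y.
apply: le_trans (ler_expect unifP uniform_h) _.
rewrite expectZ expect_swap ler_wpM2l ?exprn_ge0 //; first lra.
rewrite -[leRHS](expect_cst _ coinP); apply: ler_expect => // h.
have kap0 : 0 <= #|A2|%:R^-1 :> R by rewrite invr_ge0.
have := @expect_answersF X1 bool X2 A2 R _ h unif _ Y (q.+1 * #|Y|) T unifP kap0.
move/(_ (fun _ _ _ => lexx _)); apply: le_trans; apply: ler_expect => // f.
case runT: (run h f T) => //; rewrite ler_nat.
rewrite cardE queriesF_invert_all ?andbT => [|y].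
  case: subsetP => // -[] y yY.
  by apply: (answersF_invert_all runT); rewrite mem_enum.
by have [] := B_queries h f y.
Qed.

(** The binomial coefficient counts the [k]-subsets of the inverted set. Sets keep the targets
    distinct, as the bound on answers requires. *)
Lemma expect_binomial_inverted k :
  expect unif (fun f => expect (noisy_weights eps (phi f))
    (fun h => 'C(#|inverted h f|, k)%:R)) <=
  'C(#|A2|, k)%:R *
    ((1 + 4 * eps) ^+ (q * k) * ((q.+1 * k)%:R / #|A2|%:R) ^+ k).
Proof.
have binE (f : {ffun X2 -> A2}) (h : {ffun X1 -> bool}) : 'C(#|inverted h f|, k)%:R =
    \sum_(Y : {set A2} | #|Y| == k) (Y \subset inverted h f)%:R :> R.
  rewrite -cards_draws -sum1_card natr_sum big_mkcond [RHS]big_mkcond /=.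
  by apply: eq_bigr => Y _; rewrite inE andbC; case: (#|Y| == k) => //=; case: ifP.
under eq_expect do under eq_expect do rewrite binE.
under eq_expect do rewrite expect_sum.
rewrite expect_sum.
apply: (@le_trans _ _ (\sum_(Y : {set A2} | #|Y| == k)
   ((1 + 4 * eps) ^+ (q * k) * ((q.+1 * k)%:R / #|A2|%:R) ^+ k))).
  by apply: ler_sum => Y /eqP <-; exact: expect_subset_inverted.
by rewrite sumr_const -[leLHS]mulr_natl -card_draws cardsE.
Qed.

(** Markov on the binomial moment: if [n >= g >= 2 * k], then [k! * 'C(n, k) >= (n - k) ^ k >= (g /
    2) ^ k]. On the other side [k! * 'C(#|A2|, k)] is at most [#|A2| ^ k], which cancels the
    denominator of the moment bound. *)
Lemma inverted_tail k (g : R) : 0 < g -> 2 * k%:R <= g ->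
  expect unif (fun f => expect (noisy_weights eps (phi f))
    (fun h => (g <= #|inverted h f|%:R)%R%:R)) <=
  (2 * (1 + 4 * eps) ^+ q * (q.+1 * k)%:R / g) ^+ k.
Proof.
move=> g0 kg; have eps_bnd' := eps_bnd; set C : R := k`!%:R / (g / 2) ^+ k.
have unifP : prob_weights unif by exact: uniform_weights_prob.
have gk0 : 0 < (g / 2) ^+ k by rewrite exprn_gt0 // divr_gt0.
have C0 : 0 <= C by rewrite divr_ge0 // ltW.
have tail (f : {ffun X2 -> A2}) (h : {ffun X1 -> bool}) :
    (g <= #|inverted h f|%:R)%R%:R <= C * 'C(#|inverted h f|, k)%:R.
  case: (lerP g) => /= [G_ge|_]; last by rewrite mulr_ge0.
  rewrite /C mulrAC ler_pdivlMr // mul1r -natrM mulnC bin_ffact.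
  have le_kG : (k <= #|inverted h f|)%N by rewrite -(ler_nat R); lra.
  have := ffact_ge_exp #|inverted h f| k; rewrite -(ler_nat R) natrX natrB //.
  by apply: le_trans; rewrite lerXn2r ?nnegrE //; lra.
have step1 : expect unif (fun f => expect (noisy_weights eps (phi f))
    (fun h => (g <= #|inverted h f|%:R)%R%:R)) <=
    C * expect unif (fun f => expect (noisy_weights eps (phi f))
      (fun h => 'C(#|inverted h f|, k)%:R)).
  rewrite -expectZ; apply: ler_expect => // f; rewrite -expectZ.
  by apply: ler_expect => //; exact: noisy_weights_prob.
apply: le_trans step1 _.
apply: le_trans (ler_wpM2l C0 (expect_binomial_inverted k)) _.
have M0 : 0 < #|A2|%:R :> R by rewrite ltr0n.
rewrite [leLHS]mulrA.
have step2 : C * 'C(#|A2|, k)%:R <= (#|A2|%:R / (g / 2)) ^+ k.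
  rewrite /C mulrAC -natrM mulnC bin_ffact [leRHS]exprMn exprVn ler_pM2r ?invr_gt0 //.
  by rewrite -natrX ler_nat ffact_le_exp.
apply: le_trans (ler_wpM2r _ step2) _.
  by rewrite mulr_ge0 ?exprn_ge0 ?divr_ge0 //; lra.
rewrite exprM -!exprMn le_eqVlt; apply/orP; left; apply/eqP; congr (_ ^+ _).
by field; rewrite !lt0r_neq0.
Qed.

End InversionTail.

(** * From nontriviality to the union bound over advice *)

Section Nontrivial.
Variable R : realType.

Lemma natr_cardE (T : finType) (P : pred T) : #|P|%:R = \sum_x (P x)%:R :> R.
Proof.
rewrite -sum1_card natr_sum big_mkcond; apply: eq_bigr => x _.
by rewrite unfold_in; case: ifP.
Qed.

Lemma unif_image_sum (T V : finType) (new : T -> V) (G : V -> bool) :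
  unif_pr R (fun x => G (new x)) = \sum_v unif_image R new v * (G v)%:R.
Proof.
rewrite /unif_image /unif_pr.
under [RHS]eq_bigr do rewrite mulrAC.
rewrite -mulr_suml; congr (_ / _); rewrite natr_cardE.
under [RHS]eq_bigr do rewrite natr_cardE mulr_suml.
rewrite exchange_big; apply: eq_bigr => x _ /=.
rewrite (bigD1 (new x)) //= eqxx mul1r big1 ?addr0 // => v /negPf.
by rewrite eq_sym => ->; rewrite mul0r.
Qed.

Lemma unif_image_ge0 (T V : finType) (new : T -> V) v : 0 <= unif_image R new v.
Proof. by rewrite /unif_image /unif_pr divr_ge0. Qed.

Lemma min_entropy_le (V : finType) (p : V -> R) (rho : R) v :
  0 < rho -> ((log2 (1 / rho))%:E <= min_entropy p)%E -> p v <= rho.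
Proof.
(* Off the support the minimum says nothing, but there [p v <= 0]. *)
move=> rho0 Hp; case: (ltrP 0 (p v)) => [pv0|/le_trans->//]; last exact: ltW.
have : ((log2 (1 / rho))%:E <= (log2 (1 / p v))%:E)%E.
  by apply: le_trans Hp _; apply: bigmin_le_cond.
rewrite lee_fin /log2 ler_pM2r; last by rewrite invr_gt0 ln_gt0 // ltr1n.
by rewrite ler_ln ?posrE ?divr_gt0 // !div1r lef_pV2 ?posrE.
Qed.

End Nontrivial.

(** For every pair of oracles either the agreement is too low, or [f] has many collisions, or some
    advice inverts at least [g] images. The first two events have probability at most 1/4 each, so
    the union bound for the third is at least 1/2. *)
Lemma bb_proof_moment_bound (R : realType) (l l' t q k : nat) (rho eps g : R)
    (Con : construction l l') (Red : reduction l l' t) :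
  0 < eps <= 1 / 4 -> 0 < rho -> rho <= eps ^+ 2 ->
  nonuniform_bb_proof rho eps q Con Red -> nontrivial rho Con ->
  g = rho ^+ 2 * #|bits l|%:R / 8 -> 2 * k%:R <= g ->
  1 / 2 <= 2 ^+ t * (2 * (1 + 4 * eps) ^+ q * (q.+1 * k)%:R / g) ^+ k.
Proof.
move=> eps_bnd rho0 rho_le [Red_q Red_inv] Con_nt gE kg.
have M0 : (0 < #|bits l|)%N by rewrite card_tuple card_bool expn_gt0.
have M0r : 0 < #|bits l|%:R :> R by rewrite ltr0n.
have M0r' : 0 < #|bits l'|%:R :> R.
  by rewrite ltr0n card_tuple card_bool expn_gt0.
have g0 : 0 < g by rewrite gE !mulr_gt0 ?exprn_gt0 ?invr_gt0.
(* An explicit predictor, which avoids choosing a witness for each [f]. Its value off the range of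
   [(Con f).1] is false, and such points have mass zero. *)
pose phi (f : {ffun bits l -> bits l}) v :=
  [exists x, ((Con f).1 x == v) && (Con f).2 x].
have phiE f x : phi f ((Con f).1 x) = (Con f).2 x.
  have [[phi' phi'E] _] := Con_nt f; apply/existsP/idP => [[x'] /andP[/eqP e]|].
    by rewrite -!phi'E e.
  by move=> px; exists x; rewrite eqxx.
pose p (f : {ffun bits l -> bits l}) v := unif_image R (Con f).1 v.
have p0 f v : 0 <= p f v by exact: unif_image_ge0.
have p1 f : \sum_v p f v = 1.
  have := unif_image_sum R (Con f).1 predT; under eq_bigr do rewrite mulr1.
  by move=> <-; rewrite /unif_pr divff ?lt0r_neq0.
have p_le f v : p f v <= rho.
  by apply: min_entropy_le => //; have [] := Con_nt f.
pose agree (f : {ffun bits l -> bits l}) (h : {ffun bits l' -> bool}) : R :=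
  \sum_v p f v * (h v == phi f v)%:R.
have agreeE f (h : {ffun bits l' -> bool}) :
    unif_pr R (fun x => h ((Con f).1 x) == (Con f).2 x) = agree f h.
  rewrite /agree -(unif_image_sum R (Con f).1 (fun v => h v == phi f v)).
  by congr (_%:R / _); apply: eq_card => x; rewrite !unfold_in phiE.
pose inv alpha := inverted (fun y => Red y alpha).
have cover f h : 1 <= (agree f h < 1 / 2 + eps)%R%:R +
    ((8 * #|bits l|%:R < collisions R f)%R%:R +
     \sum_alpha (g <= #|inv alpha h f|%:R)%R%:R) :> R.
  have sum0 : 0 <= \sum_alpha (g <= #|inv alpha h f|%:R)%R%:R :> R.
    exact: sumr_ge0.
  case: (ltrP (agree f h)) => [_|agree_ge] /=.
    by rewrite lerDl addr_ge0.
  case: (ltrP (8 * _)) => [_|coll_le] /=; first by rewrite add0r lerDl.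
  rewrite !add0r; have [|alpha succ] := Red_inv f h; first by rewrite agreeE.
  suff g_le : g <= #|inv alpha h f|%:R.
    by rewrite (bigD1 alpha) //= g_le lerDl sumr_ge0.
  rewrite gE; apply: (image_count_ge rho0 coll_le).
  move: succ; rewrite /unif_pr ler_pdivlMr // => /le_trans; apply.
  rewrite ler_nat; apply: subset_leq_card; apply/subsetP => x.
  by move=> xs; rewrite inE /inv inE; exact: xs.
have unifP : prob_weights (@uniform_weights R (bits l) (bits l)).
  exact: uniform_weights_prob.
have noisyP f : prob_weights (noisy_weights eps (phi f)).
  by apply: noisy_weights_prob; lra.
pose E2 (F : {ffun bits l -> bits l} -> {ffun bits l' -> bool} -> R) :=
  expect (@uniform_weights R (bits l) (bits l))
    (fun f => expect (noisy_weights eps (phi f)) (F f)).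
have E2D F G : E2 (fun f h => F f h + G f h) = E2 F + E2 G.
  by rewrite /E2 -expectD; apply: eq_expect => f; rewrite expectD.
have total : 1 <= E2 (fun f h => (agree f h < 1 / 2 + eps)%R%:R +
    ((8 * #|bits l|%:R < collisions R f)%R%:R +
     \sum_alpha (g <= #|inv alpha h f|%:R)%R%:R)).
  rewrite -[leLHS](expect_cst 1 unifP); apply: ler_expect => // f.
  by rewrite -[leLHS](expect_cst 1 (noisyP f)); apply: ler_expect.
have bad_agree : E2 (fun f h => (agree f h < 1 / 2 + eps)%R%:R) <= 1 / 4.
  rewrite -[leRHS](expect_cst _ unifP); apply: ler_expect => // f.
  exact: (noisy_agreement_tail (phi f) (p0 f) (p1 f) (p_le f) eps_bnd rho_le).
have bad_coll :
    E2 (fun f h => (8 * #|bits l|%:R < collisions R f)%R%:R) <= 1 / 4.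
  apply: le_trans (collisions_tail R M0 (erefl _)); apply: ler_expect => // f.
  by rewrite expect_cst.
set bound := (X in _ <= _ * X).
have good : E2 (fun f h => \sum_alpha (g <= #|inv alpha h f|%:R)%R%:R)
    <= 2 ^+ t * bound.
  rewrite /E2; under eq_expect do rewrite expect_sum.
  rewrite expect_sum.
  have -> : 2 ^+ t * bound = \sum_(alpha : bits t) bound.
    by rewrite sumr_const card_tuple card_bool -[RHS]mulr_natl natrX.
  apply: ler_sum => alpha _; apply: inverted_tail => //; lra.
by move: total; rewrite !E2D; lra.
Qed.

(** * Numerical estimates and choice of parameters *)

Lemma bernoulli_sub (R : realFieldType) (x : R) n : 0 <= x <= 1 ->
  1 - n%:R * x <= (1 - x) ^+ n.
Proof.
move=> x_bnd; elim: n => [|n IH]; first by rewrite mul0r subr0 expr0.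
rewrite exprS -natr1; have x1 : 0 <= 1 - x by lra.
apply: le_trans (ler_wpM2l x1 IH); have : 0 <= n%:R :> R by [].
by nra.
Qed.

(** By Bernoulli [(1 - eps / 2) ^+ q >= 1/2], hence [(1 + eps / 2) ^+ q <= 2]. Squaring three times
    gives [1 + 4 * eps <= (1 + eps / 2) ^+ 8], whence [256 = 2 ^ 8]. *)
Lemma expr_1D4_le (R : realFieldType) (eps : R) q : 0 <= eps -> q%:R * eps <= 1 ->
  (1 + 4 * eps) ^+ q <= 256.
Proof.
move=> eps0 qe; case: q qe => [|q] qe; first by rewrite expr0; lra.
have eps1 : eps <= 1.
  by apply: le_trans qe; rewrite -natr1 mulrDl mul1r lerDr mulr_ge0.
have half : (1 + eps / 2) ^+ q.+1 <= 2.
  have b : (1 / 2 : R) <= (1 - eps / 2) ^+ q.+1.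
    by apply: le_trans (bernoulli_sub q.+1 _); lra.
  have prod : (1 + eps / 2) ^+ q.+1 * (1 - eps / 2) ^+ q.+1 <= 1.
    by rewrite -exprMn exprn_ile1 //; nra.
  have : 0 <= (1 + eps / 2) ^+ q.+1 by rewrite exprn_ge0; lra.
  by nra.
have step : 1 + 4 * eps <= (1 + eps / 2) ^+ 8.
  have e1 : 1 + eps <= (1 + eps / 2) ^+ 2 by rewrite expr2; nra.
  have e2 : 1 + 2 * eps <= (1 + eps) ^+ 2 by rewrite expr2; nra.
  have e4 : 1 + 4 * eps <= (1 + 2 * eps) ^+ 2 by rewrite expr2; nra.
  apply: le_trans e4 _; rewrite (exprM _ 2 4) (exprM _ 2 2).
  rewrite lerXn2r ?nnegrE ?exprn_ge0 //; try lra.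
  apply: le_trans e2 _; rewrite lerXn2r ?nnegrE ?exprn_ge0 //; lra.
apply: (@le_trans _ _ (((1 + eps / 2) ^+ 8) ^+ q.+1)).
  by rewrite lerXn2r ?nnegrE ?exprn_ge0 //; lra.
rewrite -exprM mulnC exprM (_ : 256 = 2 ^+ 8); last by rewrite -natrX.
by rewrite lerXn2r ?nnegrE ?exprn_ge0 //; lra.
Qed.

Theorem theorem5p11 (R : realType) :
  exists beta c : R, 0 < beta /\ 1 < c /\
  exists l0 : nat, forall l l' : nat, (l0 <= l)%N -> (l0 <= l')%N ->
  forall (t q : nat) (rho eps : R),
    t%:R <= 2 `^ (l%:R / 5) :> R ->
    0 < eps ->
    2 `^ (- (l%:R / 5)) <= rho ->
    rho <= beta * eps ^+ 2 ->
  forall (Con : construction l l') (Red : reduction l l' t),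
    nonuniform_bb_proof rho eps q Con Red ->
    nontrivial rho Con ->
    1 / eps `^ beta - c * (t%:R + l%:R) <= q%:R.
Proof.
(* The threshold 80 gives [2 ^ (l / 5) >= 2 ^ 16], just what the final ratio needs. *)
exists 1, 2; split; [lra | split; [lra |]]; exists 80%N => l l' l_ge _.
move=> t q rho eps t_le eps0 rho_ge; rewrite mul1r => rho_le Con Red bb nt.
rewrite (powRr1 (ltW eps0)) leNgt; apply/negP => q_lt.
(* The common scale: the domain has [s ^+ 5] points, while [t], [1 / rho], [1 / eps] and [q] are all
   at most [s]. *)
set s : R := 2 `^ (l%:R / 5) in t_le.
have s0 : 0 < s by rewrite powR_gt0.
have s0' := ltW s0.
have sM : s ^+ 5 = #|bits l|%:R.
  rewrite /s -powR_mulrn ?powR_ge0 // -powRrM mulfVK ?pnatr_eq0 //.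
  by rewrite powR_mulrn // card_tuple card_bool natrX.
have s_ge : 256 * 256 <= s.
  have -> : 256 * 256 = 2 `^ 16 :> R.
    have -> : 256 = 2 ^+ 8 :> R by rewrite -natrX.
    by rewrite powR_mulrn // -exprD.
  have l80 : 80 <= l%:R :> R by rewrite ler_nat.
  by rewrite ler_powR //; lra.
have rho_ge' : s^-1 <= rho by rewrite /s -powRN.
have rho0 : 0 < rho by apply: lt_le_trans rho_ge'; rewrite invr_gt0.
have t0 : 0 <= t%:R :> R by [].
have q0 : 0 <= q%:R :> R by [].
have l80 : 80 <= l%:R :> R by rewrite ler_nat.
have eps_lt : 1 / eps > 160 by lra.
have eps_bnd : 0 < eps <= 1 / 4.
  by move: eps_lt; rewrite ltr_pdivlMr //; lra.
have qeps : q%:R * eps <= 1.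
  by rewrite -ler_pdivlMr //; lra.
have eps_s : 1 / eps <= s.
  rewrite ler_pdivrMr //.
  have rs : 1 <= rho * s by rewrite -ler_pdivrMr // div1r.
  by move: rho_le; rewrite expr2; nra.
(* With [k = t + 1] the product [2 ^ t * 4 ^ -k] is at most 1/4, even for [t = 0]. *)
pose k := t.+1; pose g : R := rho ^+ 2 * #|bits l|%:R / 8.
have g_ge : s ^+ 3 / 8 <= g.
  rewrite /g -sM ler_pM2r ?invr_gt0 //.
  have -> : s ^+ 5 = s ^+ 2 * s ^+ 3 by rewrite -exprD.
  rewrite mulrA -exprMn ler_peMl ?exprn_ge0 // exprn_ege1 //.
  by rewrite -ler_pdivrMr // div1r.
have k_le : k%:R <= 2 * s by rewrite /k -natr1; lra.
have q_le : q.+1%:R <= 2 * s by rewrite -natr1; lra.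
have s3 : 256 * 256 * s ^+ 2 <= s ^+ 3.
  by rewrite (exprS s 2) ler_wpM2r ?exprn_ge0.
have ss : s <= s ^+ 2 by rewrite expr2; nra.
have g0 : 0 < g by apply: lt_le_trans g_ge; rewrite divr_gt0 ?exprn_gt0.
have kg : 2 * k%:R <= g by nra.
have := bb_proof_moment_bound eps_bnd rho0 rho_le bb nt (erefl g) kg.
apply/negP; rewrite -ltNge.
(* The numerator is at most [2 * 256 * 4 * s ^+ 2] and [g] at least [s ^+ 3 / 8], so the ratio is at
   most [2 ^ 14 / s]. *)
have ratio : 2 * (1 + 4 * eps) ^+ q * (q.+1 * k)%:R / g <= 1 / 4.
  rewrite ler_pdivrMr // natrM.
  have qk : q.+1%:R * k%:R <= 4 * s ^+ 2 :> R.
    have := ler_pM (ler0n R _) (ler0n R _) q_le k_le.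
    by move/le_trans; apply; rewrite expr2; lra.
  have lam := expr_1D4_le (ltW eps0) qeps.
  have lam0 : 0 <= (1 + 4 * eps) ^+ q by rewrite exprn_ge0; lra.
  have qk0 : 0 <= q.+1%:R * k%:R :> R by rewrite mulr_ge0.
  have := ler_pM lam0 qk0 lam qk; lra.
have ratio0 : 0 <= 2 * (1 + 4 * eps) ^+ q * (q.+1 * k)%:R / g.
  by rewrite divr_ge0 ?(ltW g0) ?mulr_ge0 ?exprn_ge0 //; lra.
apply: (@le_lt_trans _ _ (2 ^+ t * (1 / 4) ^+ k)).
  by rewrite ler_wpM2l ?exprn_ge0 // lerXn2r ?nnegrE //; lra.
rewrite /k exprS mulrCA -exprMn.
have : (2 * (1 / 4 : R)) ^+ t <= 1 by rewrite exprn_ile1; lra.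
lra.
Qed.
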